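(* Let $K$ be a commutative field of characteristic $0$, let $(B,\overline{\,\cdot\,})$ be a Cayley algebra over $K$, let $\gamma,\alpha,\beta,\delta,\theta\in K$ with $\gamma\neq0$, and let $A=E_{\gamma,\alpha,\beta,\delta,\theta}(B)$ be the generalized Cayley extension of $(B,\overline{\,\cdot\,})$ of index $(\gamma,\alpha,\beta,\delta,\theta)$. Then: (1) $A$ is associative if and only if $B$ is associative and commutative. (2) If $\beta=\gamma\theta$ and $\alpha\ne\frac12$, then $A$ is flexible if and only if $B$ is flexible.
   Context: Algebras are vector spaces with a bilinear product, not assumed associative. A unital $K$-algebra $B$ is called a Cayley (''cayleyenne'') algebra if it is equipped with an involutive anti-automorphism $x\mapsto\overline{x}$ such that $x+\overline{x}\in K1$ and $x\overline{x}\in K1$ for all $x\in B$. Write $[x,y]=xy-yx$ and $x\cdot^{\alpha}y=\alpha xy+(1-\alpha)yx$. The generalized Cayley extension $E_{\gamma,\alpha,\beta,\delta,\theta}(B)$ is the vector space $B\times B$ with product $$(x,y)(x',y')=\Big(x\cdot^{\alpha}x'+\tfrac{\beta}{2}([x,y']+[y,x'])+\gamma\,\overline{y'}y,\ \ y\overline{x'}+y'x+\tfrac{\delta}{2}[y',y]+\tfrac{\theta}{2}[x',x]\Big).$$ An algebra is flexible if $(xy)x=x(yx)$ for all $x,y$. *)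

(* Defs.v *)
From HB Require Import structures.
From mathcomp Require Import all_boot all_order all_algebra.

Set Implicit Arguments.
Unset Strict Implicit.
Unset Printing Implicit Defensive.

Import GRing.Theory.
Local Open Scope ring_scope.

(* A (not necessarily associative) K-algebra is an lmodType over the field K,
   of arbitrary dimension, together with a product {bilinear B -> B -> B}. *)

Definition flexible (T : Type) (op : T -> T -> T) : Prop :=
  forall x y, op (op x y) x = op x (op y x).

Record is_cayley (K : fieldType) (B : lmodType K)
    (mul : {bilinear B -> B -> B}) (one : B) (bar : {linear B -> B}) : Prop :=
  IsCayley {
    cayley_mul1l : left_id one mul;
    cayley_mul1r : right_id one mul;
    cayley_barK : involutive bar;
    cayley_barM : forall x y, bar (mul x y) = mul (bar y) (bar x);
    cayley_trace : forall x, exists t : K, x + bar x = t *: one;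
    cayley_norm : forall x, exists n : K, mul x (bar x) = n *: one
  }.

Section Products.
Variables (K : fieldType) (B : lmodType K) (mul : {bilinear B -> B -> B}).

Definition comm_bracket (x y : B) : B := mul x y - mul y x.

Definition alpha_mul (alpha : K) (x y : B) : B :=
  alpha *: mul x y + (1 - alpha) *: mul y x.

Definition cayley_ext (bar : {linear B -> B}) (gamma alpha beta delta theta : K)
    (p q : B * B) : B * B :=
  let: (x, y) := p in
  let: (x', y') := q in
  (alpha_mul alpha x x'
     + (beta / 2) *: (comm_bracket x y' + comm_bracket y x')
     + gamma *: mul (bar y') y,
   mul y (bar x') + mul y' x
     + (delta / 2) *: comm_bracket y' y
     + (theta / 2) *: comm_bracket x' x).

End Products.

(* The extension is itself an algebra: its product is bilinear. *)
Section Bilinearity.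
Variables (K : fieldType) (B : lmodType K) (mul : {bilinear B -> B -> B}).
Variables (bar : {linear B -> B}) (gamma alpha beta delta theta : K).

Let lin (U : lmodType K) (f : U -> B) := linear_for *:%R f.

Let linD (U : lmodType K) (f g : U -> B) :
  lin f -> lin g -> lin (fun u => f u + g u).
Proof. by move=> Hf Hg a u v; rewrite Hf Hg scalerDr addrACA. Qed.

Let linZ (U : lmodType K) (c : K) (f : U -> B) :
  lin f -> lin (fun u => c *: f u).
Proof. by move=> Hf a u v; rewrite Hf scalerDr !scalerA mulrC. Qed.

Let linN (U : lmodType K) (f : U -> B) : lin f -> lin (fun u => - f u).
Proof. by move=> Hf a u v; rewrite Hf opprD scalerN. Qed.

Let linMl (U : lmodType K) (b : B) (f : U -> B) :
  lin f -> lin (fun u => mul (f u) b).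
Proof. by move=> Hf a u v; rewrite Hf linearPl. Qed.

Let linMr (U : lmodType K) (b : B) (f : U -> B) :
  lin f -> lin (fun u => mul b (f u)).
Proof. by move=> Hf a u v; rewrite Hf linearPr. Qed.

Let linbar (U : lmodType K) (f : U -> B) : lin f -> lin (fun u => bar (f u)).
Proof. by move=> Hf a u v; rewrite Hf linearP. Qed.

Let lin1 : lin (fun p : B * B => p.1). Proof. by []. Qed.

Let lin2 : lin (fun p : B * B => p.2). Proof. by []. Qed.

Let cayley_extE p q : cayley_ext mul bar gamma alpha beta delta theta p q =
  (alpha_mul mul alpha p.1 q.1
     + (beta / 2) *: (comm_bracket mul p.1 q.2 + comm_bracket mul p.2 q.1)
     + gamma *: mul (bar q.2) p.2,
   mul p.2 (bar q.1) + mul q.2 p.1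
     + (delta / 2) *: comm_bracket mul q.2 p.2
     + (theta / 2) *: comm_bracket mul q.1 p.1).
Proof. by case: p q => [x y] []. Qed.

Lemma cayley_ext_is_bilinear :
  bilinear_for *:%R *:%R (cayley_ext mul bar gamma alpha beta delta theta).
Proof.
have pairE (h : B * B -> B * B) (f g : B * B -> B) :
    (forall p, h p = (f p, g p)) -> lin f -> lin g -> linear_for *:%R h.
  by move=> Hh Hf Hg a u v; rewrite !Hh Hf Hg.
split=> p;
  [ apply: (pairE _ _ _ (fun q => cayley_extE q p))
  | apply: (pairE _ _ _ (fun q => cayley_extE p q)) ];
  rewrite /alpha_mul /comm_bracket;
  repeat first [exact: lin1 | exact: lin2 | apply: linD | apply: linZ
               | apply: linN | apply: linMl | apply: linMr | apply: linbar].
Qed.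

HB.instance Definition _ := bilinear_isBilinear.Build K (B * B)%type (B * B)%type
  (B * B)%type *:%R *:%R (cayley_ext mul bar gamma alpha beta delta theta)
  cayley_ext_is_bilinear.

End Bilinearity.

(* Main.v *)
(* A Cayley algebra in characteristic other than 2 has an associator with
   bar (a, b, c) = (c, b, a), so the trace T z = z + bar z satisfies
   T (a, b, c) = (a, b, c) + (c, b, a), and flexibility amounts to
   T ((a b) a) = T (a (b a)).  The extension is again a Cayley algebra, with
   bar (x, y) = (bar x, - y), hence with trace (T x, 0); its flexibility is
   therefore an identity between values of T on B, and T is symmetric,
   bar-invariant and, when B is flexible, associative.  The hypothesis
   beta = gamma theta cancels the only terms that these three properties do
   not remove.  If the extension is associative, the triples
   (0, y), (0, v), (0, 1) force B to be commutative, and then all brackets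
   vanish: what remains is the classical Cayley-Dickson product. *)
From HB Require Import structures.
Require Import Defs.
From mathcomp Require Import all_boot all_order all_algebra.
From mathcomp Require Import ring.

Set Implicit Arguments.
Unset Strict Implicit.
Unset Printing Implicit Defensive.

Import GRing.Theory.
Local Open Scope ring_scope.

(** * Trace and associator of a Cayley algebra *)

Definition associator (K : fieldType) (B : lmodType K)
    (mul : {bilinear B -> B -> B}) (a b c : B) : B :=
  mul (mul a b) c - mul a (mul b c).

Definition ctrace (K : fieldType) (B : lmodType K) (bar : {linear B -> B})
    (x : B) : B :=
  x + bar x.

Section CayleyTrace.
Variables (K : fieldType) (B : lmodType K) (mul : {bilinear B -> B -> B}).
Variables (one : B) (bar : {linear B -> B}) (cB : is_cayley mul one bar).
Local Notation T := (ctrace bar).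
Local Notation assoc := (associator mul).

Let m1l := cayley_mul1l cB.
Let m1r := cayley_mul1r cB.
Let barK := cayley_barK cB.
Let barM := cayley_barM cB.

Lemma cayley_bar1 : bar one = one.
Proof. by have := barM (bar one) one; rewrite m1r barK m1r => <-. Qed.

(** Up to a multiple of [one], [bar] is negation. Since [one] commutes and associates with
    everything, conjugating one argument of a bracket or of an associator just changes its sign. *)
Lemma cayley_barE x : exists t : K, bar x = t *: one - x.
Proof.
by have [t e] := cayley_trace cB x; exists t; rewrite -e addrC addKr.
Qed.

Lemma cayley_mulVr x : mul (bar x) x = mul x (bar x).
Proof.
have [t ->] := cayley_barE x.
by rewrite linearBl linearBr linearZl_LR linearZr_LR m1l m1r.
Qed.

Lemma comm_bracketC x y : comm_bracket mul x y = - comm_bracket mul y x.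
Proof. by rewrite /comm_bracket opprB. Qed.

Lemma comm_bracket_barl x y :
  comm_bracket mul (bar x) y = - comm_bracket mul x y.
Proof.
have [t ->] := cayley_barE x; rewrite /comm_bracket linearBl linearBr.
by rewrite linearZl_LR linearZr_LR m1l m1r opprB addrC addrA subrK opprB addrC.
Qed.

Lemma comm_bracket_barr x y :
  comm_bracket mul x (bar y) = - comm_bracket mul x y.
Proof. by rewrite comm_bracketC comm_bracket_barl opprK comm_bracketC. Qed.

Lemma bar_comm_bracket x y :
  bar (comm_bracket mul x y) = comm_bracket mul (bar y) (bar x).
Proof. by rewrite /comm_bracket linearB !barM. Qed.

Lemma associator_bar1 a b c : assoc (bar a) b c = - assoc a b c.
Proof.
have [t ->] := cayley_barE a; rewrite /associator !linearBl !linearZl_LR !m1l.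
by rewrite opprB addrC addrA subrK opprB.
Qed.

Lemma associator_bar2 a b c : assoc a (bar b) c = - assoc a b c.
Proof.
have [t ->] := cayley_barE b.
rewrite /associator !(linearBl, linearBr, linearZl_LR, linearZr_LR, m1l, m1r).
by rewrite opprB addrC addrA subrK opprB.
Qed.

Lemma associator_bar3 a b c : assoc a b (bar c) = - assoc a b c.
Proof.
have [t ->] := cayley_barE c.
rewrite /associator !(linearBl, linearBr, linearZl_LR, linearZr_LR, m1l, m1r).
by rewrite opprB addrC addrA subrK opprB.
Qed.

(** Reversal of products turns the associator into minus that of [bar c], [bar b], [bar a]; removing
    the three conjugations gives three more signs, hence a plus in the end. *)
Lemma bar_associator a b c : bar (assoc a b c) = assoc c b a.
Proof.
rewrite {1}/associator linearB !barM -opprB.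
have := associator_bar1 c (bar b) (bar a).
rewrite {1}/associator => ->.
by rewrite associator_bar2 associator_bar3 !opprK.
Qed.

Lemma ctraceE x : exists t : K, T x = t *: one.
Proof. exact: cayley_trace cB x. Qed.

Lemma ctraceD x y : T (x + y) = T x + T y.
Proof. by rewrite /ctrace linearD addrACA. Qed.

Lemma ctraceN x : T (- x) = - T x.
Proof. by rewrite /ctrace linearN opprD. Qed.

Lemma ctraceB x y : T (x - y) = T x - T y.
Proof. by rewrite ctraceD ctraceN. Qed.

Lemma ctraceZ k x : T (k *: x) = k *: T x.
Proof. by rewrite /ctrace linearZ scalerDr. Qed.

Lemma ctrace_bar x : T (bar x) = T x.
Proof. by rewrite /ctrace barK addrC. Qed.

(** Conjugating both arguments leaves a bracket unchanged, so [bar] sends [x, y] to [y, x] =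
    -[x, y], and brackets have trace zero. *)
Lemma ctrace_mulC x y : T (mul x y) = T (mul y x).
Proof.
apply/eqP; rewrite -subr_eq0 -ctraceB -/(comm_bracket mul x y) /ctrace.
rewrite bar_comm_bracket comm_bracket_barl comm_bracket_barr opprK.
by rewrite comm_bracketC addNr.
Qed.

Lemma ctrace_comm_bracket x y : T (comm_bracket mul x y) = 0.
Proof. by rewrite /comm_bracket ctraceB ctrace_mulC subrr. Qed.

Lemma ctrace_associator a b c : T (assoc a b c) = assoc a b c + assoc c b a.
Proof. by rewrite /ctrace bar_associator. Qed.

(** The trace of the associator (a, b, a) is twice that associator, and 2 is invertible. Symmetry of
    the trace replaces a (b a) by (b a) a, so that both sides are products on the left. *)
Lemma flexible_ctraceP (two_neq0 : 2%:R != 0 :> K) :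
  flexible mul <-> forall a b, T (mul (mul a b) a) = T (mul (mul b a) a).
Proof.
have TassE a b : T (mul (mul a b) a) - T (mul (mul b a) a) = T (assoc a b a).
  by rewrite [in X in _ - X]ctrace_mulC -ctraceB.
split=> [flex a b | Tflex a b].
  apply/eqP; rewrite -subr_eq0 TassE ctrace_associator /associator flex.
  by rewrite subrr addr0.
have /eqP := TassE a b; rewrite Tflex subrr eq_sym ctrace_associator.
by rewrite -mulr2n -scaler_nat scaler_eq0 (negPf two_neq0) subr_eq0 => /eqP.
Qed.

(** Polarizing (a, b, a) = 0 in [a] gives (a, b, c) + (c, b, a) = 0, whose left side is the trace of
    (a, b, c). *)
Lemma flexible_ctrace_mulA : flexible mul ->
  forall a b c, T (mul (mul a b) c) = T (mul a (mul b c)).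
Proof.
move=> flex a b c; apply/eqP; rewrite -subr_eq0 -ctraceB.
rewrite -/(assoc a b c) ctrace_associator; apply/eqP.
have assoc0 x : assoc x b x = 0 by rewrite /associator flex subrr.
have assocDl x y z : assoc (x + y) b z = assoc x b z + assoc y b z.
  by rewrite /associator !linearDl opprD addrACA.
have assocDr x y z : assoc x b (y + z) = assoc x b y + assoc x b z.
  by rewrite /associator !linearDr opprD addrACA.
by have := assoc0 (a + c); rewrite assocDl !assocDr !assoc0 addr0 add0r.
Qed.

End CayleyTrace.

(** * The extension as a Cayley algebra *)

Section Extension.
Variables (K : fieldType) (B : lmodType K) (mul : {bilinear B -> B -> B}).
Variables (one : B) (bar : {linear B -> B}) (cB : is_cayley mul one bar).
Variables gamma alpha beta delta theta : K.
Local Notation T := (ctrace bar).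
Local Notation ext := (cayley_ext mul bar gamma alpha beta delta theta).

Definition ext_bar (p : B * B) : B * B := (bar p.1, - p.2).

Lemma ext_bar_is_linear : linear ext_bar.
Proof.
by move=> k p q; rewrite /ext_bar /= linearP opprD -scalerN.
Qed.

HB.instance Definition _ :=
  GRing.isLinear.Build K (B * B)%type (B * B)%type *:%R ext_bar
    ext_bar_is_linear.

Lemma comm_bracketxx x : comm_bracket mul x x = 0.
Proof. exact: subrr. Qed.

Lemma cayley_ext_cayley : is_cayley ext (one, 0) ext_bar.
Proof.
have m1l := cayley_mul1l cB; have m1r := cayley_mul1r cB.
have barK := cayley_barK cB; have bar1 := cayley_bar1 cB.
have br1l x : comm_bracket mul one x = 0 by rewrite /comm_bracket m1l m1r subrr.
have br1r x : comm_bracket mul x one = 0 by rewrite /comm_bracket m1l m1r subrr.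
have br0l x : comm_bracket mul 0 x = 0.
  by rewrite /comm_bracket linear0l linear0r subrr.
have br0r x : comm_bracket mul x 0 = 0.
  by rewrite /comm_bracket linear0l linear0r subrr.
have addaC (x : B) : alpha *: x + (1 - alpha) *: x = x.
  by rewrite -scalerDl addrC subrK scale1r.
have brNl x y : comm_bracket mul (- x) y = - comm_bracket mul x y.
  by rewrite /comm_bracket linearNl linearNr opprD.
have brNr x y : comm_bracket mul x (- y) = - comm_bracket mul x y.
  by rewrite /comm_bracket linearNl linearNr opprD.
split.
- move=> [x y]; rewrite /= /alpha_mul br1l br0l br0r br1r m1l m1r addaC.
  by rewrite !(linear0l, linear0r, linear0, scaler0, addr0, add0r) m1r.
- move=> [x y]; rewrite /= /alpha_mul br1l br0l br0r br1r m1l m1r addaC.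
  by rewrite bar1 !(linear0l, linear0r, linear0, scaler0, addr0, add0r) m1r.
- by move=> [x y]; congr (_, _); [exact: barK | exact: opprK].
- move=> [x y] [u v]; congr (_, _); rewrite /= /alpha_mul.
    rewrite !(linearD bar) !linearZ_LR /= !(cayley_barM cB).
    rewrite [bar (comm_bracket _ _ _ + _)]linearD /= !(bar_comm_bracket cB).
    rewrite !(brNl, brNr) (linearN bar) linearNl linearNr.
    rewrite !(comm_bracket_barl cB) !(comm_bracket_barr cB) barK !opprK.
    by rewrite (addrC (comm_bracket _ v x)).
  rewrite barK !(brNl, brNr, linearNl, linearNr).
  rewrite (comm_bracket_barl cB) (comm_bracket_barr cB) !opprK !opprD -!scalerN.
  by rewrite -!(comm_bracketC mul) (addrC (- mul y _)).
- move=> [x y]; have [t xE] := cayley_trace cB x; exists t.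
  rewrite /ext_bar; congr (_, _); rewrite /= ?scaler0 ?subrr //.
move=> [x y]; have [n xE] := cayley_norm cB x.
(* The sign in the norm comes from the component [- y] of the conjugate. *)
have [k yE] := cayley_norm cB y; exists (n - gamma * k).
rewrite /= /alpha_mul (cayley_mulVr cB) addaC xE barK.
rewrite !(brNl, brNr, comm_bracket_barl cB, comm_bracket_barr cB).
rewrite !comm_bracketxx (comm_bracketC mul y x) (linearN bar) !linearNl.
rewrite (cayley_mulVr cB) yE; congr (_, _); rewrite /=.
  by rewrite -opprD subrr oppr0 scaler0 addr0 scalerN scalerA -scalerBl.
by rewrite !oppr0 !scaler0 !addr0 subrr.
Qed.

(** * Trace on the extension and transfer of flexibility *)

Lemma ctrace_ext p : ctrace ext_bar p = (T p.1, 0).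
Proof. by rewrite /ctrace /ext_bar; congr (_, _); rewrite /= subrr. Qed.

(** Brackets are traceless, and the trace does not see the order of factors, so the weights [alpha]
    and 1 - [alpha] add up to 1. In an iterated product, all parameters but [gamma] thus survive
    only from the inner product. *)
Lemma ctrace_ext_mul p q :
  T (ext p q).1 = T (mul p.1 q.1) + gamma *: T (mul (bar q.2) p.2).
Proof.
case: p q => [x y] [u v] /=.
have -> w : T (alpha_mul mul alpha x u + (beta / 2) *:
    (comm_bracket mul x v + comm_bracket mul y u) + w)
    = T (alpha_mul mul alpha x u) + T w.
  rewrite ctraceD [in LHS]ctraceD ctraceZ [in T (_ + _)]ctraceD.
  by rewrite !(ctrace_comm_bracket cB) addr0 scaler0 addr0.
rewrite /alpha_mul ctraceD !ctraceZ (ctrace_mulC cB u x) -scalerDl.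
by rewrite [alpha + _]addrC subrK scale1r.
Qed.

(** By symmetry, associativity and [bar]-invariance of [T], the difference of the two sides reduces
    to ([beta] - [gamma] [theta]) T([y, u] x). *)
Lemma ctrace_ext_flexible (flex : flexible mul) (beta_eq : beta = gamma * theta)
    x y u v :
  T (ext (ext (x, y) (u, v)) (x, y)).1 = T (ext (ext (u, v) (x, y)) (x, y)).1.
Proof.
have TC := ctrace_mulC cB; have TA := flexible_ctrace_mulA cB flex.
have Tbar := ctrace_bar cB; have barM := cayley_barM cB.
have barK := cayley_barK cB.
have [t yE] := cayley_barE cB y.
(* Used on the [theta] terms, where the contributions of [t] cancel because T(u x) = T(x u). *)
have Tbary w : T (mul (bar y) w) = t *: T w - T (mul y w).
  by rewrite yE linearBl linearZl_LR (cayley_mul1l cB) ctraceB ctraceZ.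
have cancel w z : T (mul (mul z w) w) = T (mul (mul w z) w).
  by rewrite TC TA.
(* This removes the [delta] terms; it rests on [y] commuting with [bar y]. *)
have cancel_bary : T (mul (bar y) (mul v y)) = T (mul (bar y) (mul y v)).
  by rewrite -TA TC -TA -(cayley_mulVr cB) TA.
have bar_u : T (mul (bar y) (mul y (bar u))) = T (mul (bar y) (mul y u)).
  by rewrite -TA -Tbar !barM !barK TC TA.
have bar_x : T (mul (bar y) (mul v (bar x))) = T (mul (mul (bar v) y) x).
  by rewrite -TA -Tbar !barM !barK TC.
have yux : T (mul y (mul u x)) = T (mul (mul y u) x) by rewrite TA.
have yxu : T (mul y (mul x u)) = T (mul (mul u y) x).
  by rewrite TC TA TC.
rewrite !ctrace_ext_mul /= /alpha_mul /comm_bracket.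
rewrite !(linearDl, linearNl, linearZl_LR) !(linearDr, linearNr, linearZr_LR).
rewrite !(ctraceD, ctraceN, ctraceZ) bar_u bar_x !cancel cancel_bary.
rewrite -[T (mul (bar y) (mul v x))]TA.
rewrite (Tbary (mul u x)) (Tbary (mul x u)) yux yxu (TC u x) beta_eq.
(* Every remaining trace is a multiple of [one], so the identity becomes a polynomial one between
   scalars. *)
have [a ->] := ctraceE cB (mul (mul x u) x).
have [b ->] := ctraceE cB (mul (mul y u) x).
have [c ->] := ctraceE cB (mul (mul u y) x).
have [d ->] := ctraceE cB (mul (mul (bar v) y) x).
have [e ->] := ctraceE cB (mul (mul (bar y) v) x).
have [f ->] := ctraceE cB (mul (bar y) (mul y u)).
have [g ->] := ctraceE cB (mul (mul x v) x).
have [h ->] := ctraceE cB (mul (bar y) (mul y v)).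
have [s ->] := ctraceE cB (mul x u).
by rewrite !(scalerA, =^~ scaleNr, =^~ scalerDl); congr (_ *: _); ring.
Qed.

Lemma cayley_ext_flexible : flexible mul -> 2%:R != 0 :> K ->
  beta = gamma * theta -> flexible ext.
Proof.
move=> flex two_neq0 beta_eq.
apply/(flexible_ctraceP cayley_ext_cayley two_neq0) => -[x y] [u v].
by rewrite !ctrace_ext ctrace_ext_flexible.
Qed.

(** On pairs (x, 0), (u, 0) the inner product has a second component with a [theta] bracket, but it
    does not reach the trace: the outer factor has second component 0, and the outer [beta] bracket
    is traceless. Only [alpha] remains, through the factor 2 [alpha] - 1. *)
Lemma flexible_cayley_ext : 2%:R != 0 :> K -> alpha != 1 / 2 ->
  flexible ext -> flexible mul.
Proof.
move=> two_neq0 alpha_neq.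
move/(flexible_ctraceP cayley_ext_cayley two_neq0) => ext_flex.
apply/(flexible_ctraceP cB two_neq0) => x u.
have := congr1 fst (ext_flex (x, 0) (u, 0)); rewrite !ctrace_ext.
rewrite [LHS]/fst [RHS]/fst.
rewrite !ctrace_ext_mul /= /alpha_mul /comm_bracket.
have T0 : T 0 = 0 by rewrite /ctrace linear0 addr0.
rewrite !(linear0l, linear0r, linear0) !(subr0, addr0, scaler0) T0.
rewrite scaler0 !addr0 !(linearDl, linearZl_LR) !(ctraceD, ctraceZ).
set a := T (mul (mul x u) x); set b := T (mul (mul u x) x).
move/eqP; rewrite -subr_eq0.
have -> : alpha *: a + (1 - alpha) *: b - (alpha *: b + (1 - alpha) *: a)
    = (2%:R * (alpha - 1 / 2)) *: (a - b).
  have [k ->] : exists k, a = k *: one by exact: ctraceE cB _.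
  have [l ->] : exists l, b = l *: one by exact: ctraceE cB _.
  by rewrite !(scalerA, =^~ scaleNr, =^~ scalerDl); congr (_ *: _); field.
rewrite scaler_eq0 mulf_eq0 (negPf two_neq0) [alpha - _ == _]subr_eq0.
by rewrite (negPf alpha_neq) subr_eq0 => /eqP.
Qed.

(** * Associativity of the extension *)

Lemma cayley_ext_commutativeE (mulC : commutative mul) x y u v :
  ext (x, y) (u, v) =
  (mul x u + gamma *: mul (bar v) y, mul y (bar u) + mul v x).
Proof.
have br0 a b : comm_bracket mul a b = 0 by rewrite /comm_bracket mulC subrr.
rewrite /= /alpha_mul !br0 !(addr0, scaler0) (mulC u x) -scalerDl.
by rewrite [alpha + _]addrC subrK scale1r.
Qed.

Lemma cayley_ext_associative :
  associative mul -> commutative mul -> associative ext.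
Proof.
move=> mulA mulC.
have mulR a b c : mul a (mul b c) = mul b (mul c a) by rewrite mulC -mulA.
move=> [x y] [u v] [w z]; rewrite !cayley_ext_commutativeE //.
rewrite !(linearD bar) !linearZ_LR !(cayley_barM cB) /= !(cayley_barK cB).
(* In each component both sides are sums of four monomials; those on the left are brought to their
   form on the right, which leaves a reordering. *)
congr (_, _); rewrite !(linearDl, linearDr, linearZl_LR, linearZr_LR).
  have -> : mul x (mul (bar z) v) = mul (bar z) (mul v x) by rewrite mulR.
  have -> : mul (mul w (bar v)) y = mul (mul (bar v) y) w.
    by rewrite -mulA mulC.
  have -> : mul (mul (bar u) (bar z)) y = mul (bar z) (mul y (bar u)).
    by rewrite -mulA mulR.
  by rewrite mulA !scalerDr -!addrA; congr (_ + _); rewrite addrC -addrA.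
have -> : mul y (mul (bar w) (bar u)) = mul (mul y (bar u)) (bar w).
  by rewrite (mulC (bar w)) mulA.
have -> : mul y (mul (bar v) z) = mul z (mul (bar v) y).
  by rewrite (mulC _ z) [RHS]mulR [RHS]mulR.
have -> : mul (mul v (bar w)) x = mul (mul v x) (bar w).
  by rewrite -mulA (mulC (bar w)) mulA.
rewrite -[mul (mul z u) x]mulA (mulC u) -!addrA; congr (_ + _).
by rewrite addrC -addrA.
Qed.

Lemma associative_cayley_ext : gamma != 0 ->
  associative ext -> associative mul /\ commutative mul.
Proof.
move=> gamma_neq0 extA.
have mulC : commutative mul.
  (* The second components are [gamma] y v and [gamma] v y. The middle entry is [bar v] because it
     gets conjugated on both sides; the last entry [one] makes the [delta] brackets vanish. *)
  move=> y v; have := congr1 snd (extA (0, y) (0, bar v) (0, one)).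
  rewrite /= /alpha_mul /comm_bracket (cayley_bar1 cB) (cayley_barK cB).
  rewrite !(cayley_mul1l cB) !(cayley_mul1r cB).
  rewrite !(linear0, linear0l, linear0r).
  rewrite !(subrr, oppr0, linear0l, linear0r, addr0, add0r, scaler0).
  rewrite linearZ_LR /= (cayley_barK cB) linearZr_LR.
  exact: (scalerI gamma_neq0).
have extE := cayley_ext_commutativeE mulC.
split=> // x u w; have := congr1 fst (extA (x, 0) (u, 0) (w, 0)).
rewrite (extE x 0 u) (extE u 0 w) !extE [LHS]/fst [RHS]/fst.
by rewrite !(linear0, linear0l, linear0r, addr0, scaler0).
Qed.

End Extension.

Theorem proposition3p17 (K : fieldType) (char0 : [pchar K] =i pred0)
    (B : lmodType K) (mul : {bilinear B -> B -> B}) (one : B)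
    (bar : {linear B -> B}) (cayleyB : is_cayley mul one bar)
    (gamma alpha beta delta theta : K) (gamma_neq0 : gamma <> 0) :
  (associative (cayley_ext mul bar gamma alpha beta delta theta) <->
     associative mul /\ commutative mul) /\
  (beta = gamma * theta -> alpha <> 1 / 2 ->
     (flexible (cayley_ext mul bar gamma alpha beta delta theta) <->
        flexible mul)).
Proof.
have two_neq0 : 2%:R != 0 :> K by rewrite (pcharf0P K).1.
split.
  split; first by apply: (associative_cayley_ext cayleyB); apply/eqP.
  by case=> mulA mulC; apply: (cayley_ext_associative cayleyB).
move=> beta_eq /eqP alpha_neq; split.
  exact: (flexible_cayley_ext cayleyB).
by move=> flex; apply: (cayley_ext_flexible cayleyB).
Qed.
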